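(* Let $\mathbf{k}$ be a field, $R=\mathbf{k}[\![x_1,\dots,x_n]\!]$, let $A=R/I$ be an Artin ring of Gorenstein colength $t$, and let $G=R/\mathrm{Ann}_R F$ be a minimal Gorenstein cover of $A$. Then: (i) $F\in\int_{\mathfrak m^t}I^\perp$; (ii) for any $H\in\int_{\mathfrak m^t}I^\perp$, the condition $I^\perp\subset\langle H\rangle$ does not depend on the representative of the class $\overline{H}$ of $H$ in $\mathcal{L}_{A,t}=\int_{\mathfrak m^t}I^\perp/I^\perp$. In particular, any $F'\in\int_{\mathfrak m^t}I^\perp$ such that $\overline{F'}=\overline{F}$ in $\mathcal{L}_{A,t}$ defines the same minimal Gorenstein cover $G=R/\mathrm{Ann}_R F$.
   Context: $\mathfrak m$ is the maximal ideal of $R=\mathbf{k}[\![x_1,\dots,x_n]\!]$ and $S=\mathbf{k}[y_1,\dots,y_n]$ is an $R$-module by contraction: $x^\alpha\circ y^\beta=y^{\beta-\alpha}$ if $\beta\ge\alpha$ componentwise and $0$ otherwise. For an ideal $I$ of $R$, $I^\perp=\{G\in S: I\circ G=0\}$; for $F\in S$, $\langle F\rangle=R\circ F$ is the $R$-submodule generated by $F$ and $\mathrm{Ann}_R F=\{f\in R: f\circ F=0\}$. For an ideal $K$ of $R$ and an $R$-submodule $M$ of $S$, $\int_K M=\{G\in S: K\circ G\subset M\}$. $\ell$ denotes length. For $A=R/I$ Artin, $G=R/\mathrm{Ann}_R F$ is a Gorenstein cover of $A$ if $I^\perp\subset\langle F\rangle$. The Gorenstein colength is $\mathrm{gcl}(A)=\min\{\ell(G)-\ell(A):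 G \text{ a Gorenstein cover of } A\}$, and a Gorenstein cover $G$ is minimal if $\ell(G)=\ell(A)+\mathrm{gcl}(A)$.
   Formalization: Part (ii) and the ''in particular'' claim are stated only for Gorenstein colength t > 0; for t = 0 they fail for every nonzero Gorenstein A (e.g. I = m, F = 1, F' = 0 have the same class, but 0 does not define a cover). *)

(* Defs.v *)
From HB Require Import structures.
From mathcomp Require Import all_boot all_order all_algebra.
From mathcomp Require Import boolp.
From mathcomp Require Import mpoly.

Set Implicit Arguments.
Unset Strict Implicit.
Unset Printing Implicit Defensive.

Import GRing.Theory.
Local Open Scope ring_scope.
Local Open Scope quotient_scope.

Notation ideal R := (submodClosed (R^o)%type).

Section QuotientModule.
Variables (R : pzRingType) (V : lmodType R) (W : submodClosed V).

(** [submodClosed] does not inherit from [zmodClosed] in the hierarchy, although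
    closure under opposites follows from closure under scaling by [-1]. *)
Definition submod_zmod : {pred V} := W.
Fact submod_zmod_closed : zmod_closed submod_zmod.
Proof. exact: GRing.submod_closedB (submodClosedP W). Qed.
HB.instance Definition _ := GRing.isZmodClosed.Build V submod_zmod
  submod_zmod_closed.

Local Notation quot := (Quotient.quot submod_zmod).

Definition quotmod : Type := quot.
HB.instance Definition _ := GRing.Zmodule.on quotmod.

Definition quotmod_pi : V -> quotmod := \pi_quot.
Definition quotmod_scale (a : R) (x : quotmod) : quotmod :=
  quotmod_pi (a *: repr (x : quot)).

Lemma quotmod_piP x y : quotmod_pi x = quotmod_pi y <-> x - y \in W.
Proof.
by rewrite -[_ \in W]/(x - y \in submod_zmod) Quotient.idealrBE; split=> /eqP.
Qed.

Lemma quotmod_pi_surj (x : quotmod) : exists v, x = quotmod_pi v.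
Proof. by exists (repr (x : quot)); rewrite /quotmod_pi reprK. Qed.

Lemma quotmod_piD x y : quotmod_pi (x + y) = quotmod_pi x + quotmod_pi y.
Proof. exact: (raddfD (\pi_quot)). Qed.

Lemma quotmod_scale_pi a v : quotmod_scale a (quotmod_pi v) = quotmod_pi (a *: v).
Proof.
apply/quotmod_piP; rewrite -scalerBr; apply: rpredZ; apply/quotmod_piP.
by rewrite /quotmod_pi reprK.
Qed.

Fact quotmod_scaleA a b x :
  quotmod_scale a (quotmod_scale b x) = quotmod_scale (a * b) x.
Proof. by have [v ->] := quotmod_pi_surj x; rewrite !quotmod_scale_pi scalerA. Qed.

Fact quotmod_scale1 : left_id 1 quotmod_scale.
Proof.
by move=> x; have [v ->] := quotmod_pi_surj x; rewrite quotmod_scale_pi scale1r.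
Qed.

Fact quotmod_scaleDr : right_distributive quotmod_scale +%R.
Proof.
move=> a x y; have [v ->] := quotmod_pi_surj x; have [w ->] := quotmod_pi_surj y.
by rewrite -quotmod_piD !quotmod_scale_pi -quotmod_piD scalerDr.
Qed.

Fact quotmod_scaleDl x : {morph quotmod_scale^~ x : a b / a + b}.
Proof.
move=> a b; have [v ->] := quotmod_pi_surj x.
by rewrite !quotmod_scale_pi -quotmod_piD scalerDl.
Qed.

HB.instance Definition _ := GRing.Zmodule_isLmodule.Build R quotmod
  quotmod_scaleA quotmod_scale1 quotmod_scaleDr quotmod_scaleDl.

End QuotientModule.

Arguments quotmod_pi {R V} W x.

Section Length.
Variables (R : pzRingType) (V : lmodType R).

Definition submod_chain (M : nat -> {pred V}) (l : nat) :=
  (forall i, (i <= l)%N -> submod_closed (M i)) /\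
  (forall i, (i < l)%N -> {subset M i <= M i.+1} /\ ~ {subset M i.+1 <= M i}).

Definition has_length (l : nat) :=
  (exists M, submod_chain M l) /\
  (forall M l', submod_chain M l' -> (l' <= l)%N).

Definition artinian :=
  forall M : nat -> {pred V},
    (forall i, submod_closed (M i)) -> (forall i, {subset M i.+1 <= M i}) ->
    exists N, forall i, (N <= i)%N -> M i =i M N.

End Length.

Arguments has_length {R} V l.
Arguments artinian {R} V.

Section Ideals.
Variable R : comPzRingType.

Definition ideal_mul (I J : {pred R}) : {pred R} := fun f =>
  `[< exists2 s : seq (R * R), all (fun p => (p.1 \in I) && (p.2 \in J)) s
        & f = \sum_(p <- s) p.1 * p.2 >].

Fixpoint ideal_exp (I : {pred R}) (t : nat) : {pred R} :=
  if t is t'.+1 then ideal_mul I (ideal_exp I t') else predT.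

Variable V : lmodType R.

Definition annihilator (F : V) : {pred R^o} := fun f => f *: F == 0.

Definition cyclic_submod (F : V) : {pred V} := fun G =>
  `[< exists f : R, G = f *: F >].

Definition perp (I : {pred R^o}) : {pred V} := fun G =>
  `[< forall f : R, f \in I -> f *: G = 0 >].

(** The module-theoretic [\int_K M], i.e. the colon of [M] by [K] in [V]. *)
Definition integral (K : {pred R}) (M : {pred V}) : {pred V} := fun G =>
  `[< forall f, f \in K -> f *: G \in M >].

Fact annihilator_closed F : submod_closed (annihilator F).
Proof.
split=> [|a u v /eqP uF /eqP vF]; rewrite ?inE /annihilator unfold_in.
  by rewrite scale0r.
by rewrite scalerDl -scalerA uF vF scaler0 addr0.
Qed.

Fact perp_closed I : submod_closed (perp I).
Proof.
split=> [|a u v /asboolP uI /asboolP vI]; apply/asboolP => f fI.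
  by rewrite scaler0.
by rewrite scalerDr scalerA mulrC -scalerA uI // vI // scaler0 addr0.
Qed.

HB.instance Definition _ F := GRing.isSubmodClosed.Build R R^o (annihilator F)
  (GRing.submod_closed_semi (annihilator_closed F)).
HB.instance Definition _ I := GRing.isSubmodClosed.Build R V (perp I)
  (GRing.submod_closed_semi (perp_closed I)).

End Ideals.

Record pseries (k : fieldType) (n : nat) :=
  PSeries { pscoef :> 'X_{1..n} -> k }.

HB.instance Definition _ k n := gen_eqMixin (pseries k n).
HB.instance Definition _ k n := gen_choiceMixin (pseries k n).

Section PowerSeries.
Variables (k : fieldType) (n : nat).
Implicit Types (f g h : pseries k n) (m : 'X_{1..n}).

Lemma pseriesP f g : (forall m, f m = g m) -> f = g.
Proof. by case: f g => [f] [g] /= E; congr PSeries; apply/funext. Qed.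

Definition ps_add f g := PSeries (fun m => f m + g m).
Definition ps_opp f := PSeries (fun m => - f m).
Definition ps_zero : pseries k n := PSeries (fun=> 0).
Definition ps_one : pseries k n := PSeries (fun m => (m == 0%MM)%:R).

(** Cauchy product: pairs [(a, b)] with [a + b = m] have total degrees at most
    that of [m], whence the bounds making the index type finite. *)
Definition ps_mul f g := PSeries (fun m =>
  \sum_(ab : 'X_{1..n < (mdeg m).+1, (mdeg m).+1} | m == (ab.1 + ab.2)%MM)
    f ab.1 * g ab.2).

Fact ps_addA : associative ps_add.
Proof. by move=> f g h; apply: pseriesP => m /=; rewrite addrA. Qed.
Fact ps_addC : commutative ps_add.
Proof. by move=> f g; apply: pseriesP => m /=; rewrite addrC. Qed.
Fact ps_add0 : left_id ps_zero ps_add.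
Proof. by move=> f; apply: pseriesP => m /=; rewrite add0r. Qed.
Fact ps_addN : left_inverse ps_zero ps_opp ps_add.
Proof. by move=> f; apply: pseriesP => m /=; rewrite addNr. Qed.

HB.instance Definition _ := GRing.isZmodule.Build (pseries k n)
  ps_addA ps_addC ps_add0 ps_addN.

Definition ps_trunc d f : {mpoly k[n]} := \sum_(m : 'X_{1..n < d}) f m *: 'X_[m].

Lemma ps_truncE d f m : (mdeg m < d)%N -> (ps_trunc d f)@_m = f m.
Proof. exact: mcoeff_mpoly. Qed.

Lemma ps_mul_mpoly f g (p q : {mpoly k[n]}) m :
    (forall a, (mdeg a <= mdeg m)%N -> p@_a = f a) ->
    (forall a, (mdeg a <= mdeg m)%N -> q@_a = g a) ->
  ps_mul f g m = (p * q)@_m.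
Proof.
move=> pf qg; rewrite mcoeffM; apply: eq_bigr => -[[a la] [b lb]] /= _.
by rewrite pf ?qg.
Qed.

Lemma ps_mul_wide d f g m : (mdeg m < d)%N ->
  ps_mul f g m =
  \sum_(ab : 'X_{1..n < d, d} | m == (ab.1 + ab.2)%MM) f ab.1 * g ab.2.
Proof.
move=> md; rewrite (@ps_mul_mpoly _ _ (ps_trunc d f) (ps_trunc d g)).
- rewrite (mcoeff_poly_mul _ _ md); apply: eq_bigr => -[[a la] [b lb]] /= _.
  by rewrite !ps_truncE.
- by move=> a la; rewrite ps_truncE // (leq_ltn_trans la).
- by move=> a la; rewrite ps_truncE // (leq_ltn_trans la).
Qed.

Lemma ps_mul_trunc d f g m : (mdeg m < d)%N ->
  (ps_trunc d f * ps_trunc d g)@_m = ps_mul f g m.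
Proof.
by move=> md; rewrite -(@ps_mul_mpoly f g) // => a la; rewrite ps_truncE // (leq_ltn_trans la).
Qed.

Fact ps_mulA : associative ps_mul.
Proof.
move=> f g h; apply: pseriesP => m; set d := (mdeg m).+1.
have tE u v a : (mdeg a <= mdeg m)%N ->
    (ps_trunc d u * ps_trunc d v)@_a = ps_mul u v a.
  by move=> la; rewrite ps_mul_trunc.
have tE1 u a : (mdeg a <= mdeg m)%N -> (ps_trunc d u)@_a = u a.
  by move=> la; rewrite ps_truncE.
rewrite (@ps_mul_mpoly f _ (ps_trunc d f) (ps_trunc d g * ps_trunc d h)).
- rewrite (@ps_mul_mpoly _ h (ps_trunc d f * ps_trunc d g) (ps_trunc d h)).
  + by rewrite mulrA.
  + exact: tE.
  + exact: tE1.
- exact: tE1.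
- exact: tE.
Qed.

Fact ps_mulC : commutative ps_mul.
Proof.
by move=> f g; apply: pseriesP => m; rewrite -!(@ps_mul_trunc (mdeg m).+1) // mulrC.
Qed.

Fact ps_mul1 : left_id ps_one ps_mul.
Proof.
move=> f; apply: pseriesP => m.
rewrite (@ps_mul_mpoly _ _ 1 (ps_trunc (mdeg m).+1 f)) ?mul1r ?ps_truncE //.
- by move=> a _; rewrite mcoeff1.
- by move=> a la; rewrite ps_truncE.
Qed.

Fact ps_mulDl : left_distributive ps_mul +%R.
Proof.
move=> f g h; apply: pseriesP => m; rewrite /= -big_split /=.
by apply: eq_bigr => i _; rewrite mulrDl.
Qed.

Fact ps_one_neq0 : ps_one != 0.
Proof.
by apply/eqP => /(congr1 (fun f : pseries k n => f 0%MM)) /eqP; rewrite /= eqxx oner_eq0.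
Qed.

HB.instance Definition _ := GRing.Zmodule_isComNzRing.Build (pseries k n)
  ps_mulA ps_mulC ps_mul1 ps_mulDl ps_one_neq0.

(** A power series over a field is invertible iff its constant term is not 0. *)
Definition max_ideal : {pred pseries k n} := fun f => f 0%MM == 0.

End PowerSeries.

Arguments max_ideal {k n}.

(** A copy of [{mpoly k[n]}]: the scalars of its module structure are the power
    series rather than the constants. *)
Definition contr_poly (k : fieldType) (n : nat) : Type := {mpoly k[n]}.
HB.instance Definition _ k n := GRing.Zmodule.on (contr_poly k n).

Section Contraction.
Variables (k : fieldType) (n : nat).
Implicit Types (f g : pseries k n) (G : {mpoly k[n]}).

Definition contr_mon (a b : 'X_{1..n}) : {mpoly k[n]} :=
  if (a <= b)%MM then 'X_[b - a] else 0.

(** Monomials [x^a] with [mdeg a > mdeg b] kill [y^b], so that the sum over the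
    terms of [f] is finite. *)
Definition contract f G : {mpoly k[n]} :=
  \sum_(b <- msupp G) \sum_(a : 'X_{1..n < (mdeg b).+1})
    (f a * G@_b) *: contr_mon a b.

Lemma contr_monE a b m : (contr_mon a b)@_m = (b == m + a)%MM%:R.
Proof.
rewrite /contr_mon; case: ifP => [ab|/negP ab]; last first.
  by rewrite mcoeff0; case: eqP => // E; case: ab; rewrite E lem_addl.
rewrite mcoeffX; congr (nat_of_bool _)%:R; apply/eqP/eqP => [<-|->].
  by rewrite submK.
by rewrite addmK.
Qed.

Lemma sum_bmnm1 d (h : 'X_{1..n} -> k) b m :
  \sum_(a : 'X_{1..n < d}) h a * (b == m + a)%MM%:R =
  if (m <= b)%MM && (mdeg (b - m)%MM < d)%N then h (b - m)%MM else 0.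
Proof.
case: ifP => [/andP[mb bd]|C].
  rewrite (bigD1 (BMultinom bd)) //= big1 ?addr0.
    by rewrite addmC submK // eqxx mulr1.
  move=> a; rewrite bmeqP /= => /eqP ne; case: eqP => [E|]; rewrite ?mulr0 //.
  by case: ne; rewrite E addmC addmK.
apply: big1 => -[a ad] /= _; case: eqP => [E|]; rewrite ?mulr0 //.
by rewrite E lem_addr addmC addmK ad in C.
Qed.

Lemma mcoeff_contract d f G m : (msize G <= d)%N ->
  (contract f G)@_m = \sum_(a : 'X_{1..n < d}) f a * G@_(m + a).
Proof.
move=> Gd; transitivity (\sum_(b <- msupp G)
    \sum_(a : 'X_{1..n < d}) (f a * G@_b) * (b == m + a)%MM%:R); last first.
  rewrite exchange_big; apply: eq_bigr => a _ /=.
  rewrite [in RHS](mpolyE G) raddf_sum mulr_sumr; apply: eq_bigr => b _ /=.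
  by rewrite mcoeffZ mcoeffX mulrA.
rewrite /contract raddf_sum; apply: eq_big_seq => b bG /=; rewrite raddf_sum /=.
have bd : (mdeg b < d)%N by apply: leq_trans Gd; apply: msize_mdeg_lt.
under eq_bigr => a _ do rewrite mcoeffZ contr_monE.
rewrite !(sum_bmnm1 _ (fun a => f a * G@_b)) ltnS mdegB.
by rewrite (leq_ltn_trans (mdegB _ _) bd).
Qed.

Fact contract_mul f g G : contract f (contract g G) = contract (f * g) G.
Proof.
apply/mpolyP => m; pose d := maxn (msize G) (msize (contract g G)).
have Gd : (msize G <= d)%N by apply: leq_maxl.
rewrite !(@mcoeff_contract d) ?leq_maxr //.
transitivity (\sum_(ab : 'X_{1..n < d, d})
    f ab.1 * g ab.2 * G@_(m + (ab.1 + ab.2))).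
  rewrite -(pair_bigA _ (fun a b : 'X_{1..n < d} =>
    f a * g b * G@_(m + (a + b)))) /=; apply: eq_bigr => a _.
  rewrite (mcoeff_contract _ _ Gd) mulr_sumr; apply: eq_bigr => b _.
  by rewrite mulrA addmA.
under [RHS]eq_bigr => c _.
  rewrite [(f * g) c](@ps_mul_wide _ _ d) ?bmdeg // big_mkcond mulr_suml /=.
  over.
rewrite exchange_big /=; apply: eq_bigr => -[a b] _ /=.
transitivity (\sum_(c : 'X_{1..n < d})
    (f a * g b * G@_(m + c)) * ((a + b)%MM == 0 + c)%MM%:R).
  rewrite (sum_bmnm1 _ (fun c => f a * g b * G@_(m + c))) subm0 (_ : (0 <= _)%MM) /=; last first.
    by apply/mnm_lepP => i; rewrite mnm0E.
  case: ltnP => // le; rewrite [G@__]memN_msupp_eq0 ?mulr0 //.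
  by apply: msize_mdeg_ge; rewrite mdegD (leq_trans Gd) // (leq_trans le) // leq_addl.
apply: eq_bigr => c _; rewrite add0m eq_sym.
by case: eqP => _; rewrite ?mulr1 // mulr0 mul0r.
Qed.

Fact contract1 : left_id 1 contract.
Proof.
move=> G; apply/mpolyP => m; rewrite (@mcoeff_contract (msize G).+1) //.
rewrite (bigD1 bm0) //= eqxx mul1r addm0 big1 ?addr0 // => a.
by rewrite bmeqP /= => /negbTE ->; rewrite mul0r.
Qed.

Fact contractDr : right_distributive contract +%R.
Proof.
move=> f G H; apply/mpolyP => m.
pose d := maxn (msize (G + H)) (maxn (msize G) (msize H)).
rewrite mcoeffD !(@mcoeff_contract d) ?leq_max ?leqnn ?orbT // -big_split.
by apply: eq_bigr => a _; rewrite mcoeffD mulrDr.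
Qed.

Fact contractDl G : {morph contract^~ G : f g / f + g}.
Proof.
move=> f g; apply/mpolyP => m.
rewrite mcoeffD !(mcoeff_contract _ _ (leqnn _)) -big_split.
by apply: eq_bigr => a _; rewrite mulrDl.
Qed.

HB.instance Definition _ := GRing.Zmodule_isLmodule.Build (pseries k n)
  (contr_poly k n) contract_mul contract1 contractDr contractDl.

End Contraction.

Section GorensteinCovers.
Variables (k : fieldType) (n : nat).
Local Notation R := (pseries k n).
Local Notation S := (contr_poly k n).
Implicit Types (I : ideal R) (F : S).

Definition gorenstein_cover I F : Prop :=
  {subset (perp I : {pred S}) <= cyclic_submod F}.

(** [l(R / Ann_R F) - l(R / I) = s]; for a cover [Ann_R F] is contained in [I],
    so that the difference is never negative. *)
Definition length_gap I F (s : nat) : Prop :=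
  exists a g : nat, [/\ has_length (quotmod I) a,
    has_length (quotmod (annihilator F)) g & g = (a + s)%N].

(** [gcl(R / I) = t]. *)
Definition has_gcl I (t : nat) : Prop :=
  (exists F, gorenstein_cover I F /\ length_gap I F t) /\
  (forall F s, gorenstein_cover I F -> length_gap I F s -> (t <= s)%N).

Definition minimal_gorenstein_cover I F : Prop :=
  gorenstein_cover I F /\ exists t, has_gcl I t /\ length_gap I F t.

End GorensteinCovers.

(* Main.v *)
(** If [R/J] has length at most [l], then [m^l] lies in [J]: otherwise the partial
    products of some [x_1, ..., x_l] in [m] with [x_1 ... x_l] outside [J] would
    give a chain of length [l + 1]. Hence [m^N <= I] for some [N], linear algebra
    in [R/m^N] shows that every ideal [J] containing [I] is the annihilator of its
    perp, and strict chains above [I] turn into strict chains of perps inside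
    [perp I]. For a cover [F], pulling these back along [f |-> f F] and adding a
    chain above [J = (perp I : F)] bounds the length of [R/J] by the length gap
    [t]; therefore [m^t F] lies in [perp I]. For the other parts, if [perp I] is
    contained in [<H>] and [H - H' = g H] is in [perp I], then either [g] is in
    [m] and [H' = (1 - g) H] is a unit multiple of [H], or [g] is a unit, so that
    [<H> = perp I] and [Ann H = I], which forces [t = 0]. *)
Require Import Defs.
From HB Require Import structures.
From mathcomp Require Import all_boot all_order all_algebra.
From mathcomp Require Import boolp.
From mathcomp Require Import mpoly ring.

Set Implicit Arguments.
Unset Strict Implicit.
Unset Printing Implicit Defensive.

Import GRing.Theory.
Local Open Scope ring_scope.

(** * Chains of submodules and lengths of quotients *)

Section Chains.
Variables (R : pzRingType) (V : lmodType R).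

Definition chain_above (W : {pred V}) (M : nat -> {pred V}) (l : nat) :=
  submod_chain M l /\ {subset W <= M 0%N}.

(** The length of [V / W], measured by chains inside [V]. As [W] is a bare predicate, it can be
    exchanged for one with the same elements. *)
Definition colength (W : {pred V}) (l : nat) :=
  (exists M, chain_above W M l) /\
  (forall M l', chain_above W M l' -> (l' <= l)%N).

Lemma submod_chain_mono (M : nat -> {pred V}) l i j :
  submod_chain M l -> (i <= j)%N -> (j <= l)%N -> {subset M i <= M j}.
Proof.
move=> [_ Mlt]; elim: j => [|j IHj]; first by rewrite leqn0 => /eqP-> _ v.
rewrite leq_eqVlt => /predU1P[-> _ v //|ij] jl v vM.
by apply: (Mlt j jl).1; apply: IHj => //; apply: ltnW.
Qed.

(** The junction costs no step: [M l1] gives way to the possibly larger [N 0], and the last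
    inclusion into it stays strict. *)
Lemma submod_chain_cat (M N : nat -> {pred V}) l1 l2 :
  submod_chain M l1 -> submod_chain N l2 -> {subset M l1 <= N 0%N} ->
  submod_chain (fun i => if (i < l1)%N then M i else N (i - l1)%N) (l1 + l2).
Proof.
move=> [Mcl Mlt] [Ncl Nlt] MN; split=> i il.
  by case: ltnP => i1; [apply/Mcl/ltnW | apply: Ncl; rewrite leq_subLR].
case: (ltnP i l1) => [i1|l1i].
  have [Mi nMi] := Mlt i i1.
  case: ltnP => [//|i2]; have e : i.+1 = l1 by apply/eqP; rewrite eqn_leq i1.
  rewrite e subnn; rewrite e in Mi nMi; split=> [v vM|NM]; first exact/MN/Mi.
  by apply: nMi => v vM; apply/NM/MN.
rewrite ltnNge (leq_trans l1i (leqnSn i)) /= subSn //.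
by apply: Nlt; rewrite ltn_subLR.
Qed.

Variable W : submodClosed V.

Lemma quotmod_pi0 : quotmod_pi W 0 = 0.
Proof. by apply: (addIr (quotmod_pi W 0)); rewrite -quotmod_piD !add0r. Qed.

Lemma quotmod_pi_lin a u v :
  quotmod_pi W (a *: u + v) = a *: quotmod_pi W u + quotmod_pi W v.
Proof. by rewrite quotmod_piD -quotmod_scale_pi. Qed.

(** Every term contains [W], so membership depends only on the class modulo [W] and strict
    inclusions survive in the quotient. *)
Lemma chain_above_image M l : chain_above W M l ->
  submod_chain (V := quotmod W)
    (fun i x => `[< exists2 v, v \in M i & x = quotmod_pi W v >]) l.
Proof.
move=> [[Mcl Mlt] WM].
have MW i v w : (i <= l)%N -> w \in M i -> quotmod_pi W v = quotmod_pi W w ->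
    v \in M i.
  move=> il wM /quotmod_piP vw; rewrite -(subrK w v).
  have [_ ML] := Mcl i il.
  rewrite -[v - w]scale1r; apply: (ML) => //.
  exact/(submod_chain_mono (conj Mcl Mlt) (leq0n i) il)/WM.
split=> i il.
  have [M0 ML] := Mcl i il; split.
    by apply/asboolP; exists 0; rewrite ?quotmod_pi0.
  move=> a _ _ /asboolP[u uM ->] /asboolP[v vM ->]; apply/asboolP.
  by exists (a *: u + v); rewrite ?quotmod_pi_lin //; apply: ML.
have [Mi nMi] := Mlt i il; split=> [_ /asboolP[v vM ->]|H].
  by apply/asboolP; exists v => //; apply: Mi.
apply: nMi => v vM.
have /asboolP[w wM] : quotmod_pi W v \in
    (fun x => `[< exists2 v, v \in M i & x = quotmod_pi W v >]).
  by apply: H; apply/asboolP; exists v.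
by apply: MW => //; apply: ltnW.
Qed.

Lemma chain_above_preimage (N : nat -> {pred quotmod W}) l :
  submod_chain N l -> chain_above W (fun i v => quotmod_pi W v \in N i) l.
Proof.
move=> [Ncl Nlt]; split; last first.
  move=> v vW; rewrite unfold_in.
  have -> : quotmod_pi W v = 0 by rewrite -quotmod_pi0; apply/quotmod_piP; rewrite subr0.
  by have [] := Ncl 0%N isT.
split=> i il.
  have [N0 NL] := Ncl i il; split=> [|a u v]; rewrite !unfold_in ?quotmod_pi0 //.
  by rewrite quotmod_pi_lin; apply: NL.
have [Ni nNi] := Nlt i il; split=> [v|H]; first by rewrite !unfold_in; apply: Ni.
apply: nNi => x; have [v ->] := quotmod_pi_surj x => vN.
exact: H.
Qed.

Lemma has_length_quotmod l : has_length (quotmod W) l <-> colength W l.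
Proof.
split=> -[[M Mch] maxl]; split.
- by eexists; apply: chain_above_preimage Mch.
- by move=> N l' /chain_above_image/maxl.
- by eexists; apply: chain_above_image Mch.
- by move=> N l' /chain_above_preimage/maxl.
Qed.

End Chains.

Lemma eq_colength (R : pzRingType) (V : lmodType R) (W W' : {pred V}) l :
  W =i W' -> colength W l -> colength W' l.
Proof.
move=> eW [[M [Mch MW]] maxl]; split.
  by exists M; split=> // v; rewrite -eW; apply: MW.
by move=> N l' [Nch NW]; apply: (maxl N); split=> // v; rewrite eW; apply: NW.
Qed.

Lemma colength_uniq (R : pzRingType) (V : lmodType R) (W : {pred V}) l l' :
  colength W l -> colength W l' -> l = l'.
Proof.
move=> [[M Mch] maxl] [[M' M'ch] maxl'].
by apply/eqP; rewrite eqn_leq (maxl' _ _ Mch) (maxl _ _ M'ch).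
Qed.

(** * Orders, inverses and powers of the maximal ideal for power series *)

Section Series.
Variables (k : fieldType) (n : nat).
Local Notation R := (pseries k n).
Implicit Types (f g h x : R) (m a b : 'X_{1..n}).

Lemma pscoef_sum (J : Type) (r : seq J) (P : pred J) (F : J -> R) m :
  pscoef (\sum_(i <- r | P i) F i) m = \sum_(i <- r | P i) F i m.
Proof. by apply: (big_morph (fun f => pscoef f m)). Qed.

Lemma pscoefM0 f g : (f * g) 0%MM = f 0%MM * g 0%MM.
Proof.
rewrite -[LHS]/(ps_mul f g 0%MM).
rewrite (@ps_mul_mpoly _ _ f g (f 0%MM)%:MP (g 0%MM)%:MP).
- by rewrite -mpolyCM mcoeffC eqxx mulr1.
- by move=> a; rewrite mdeg0 leqn0 mdeg_eq0 => /eqP->; rewrite mcoeffC eqxx mulr1.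
- by move=> a; rewrite mdeg0 leqn0 mdeg_eq0 => /eqP->; rewrite mcoeffC eqxx mulr1.
Qed.

Lemma pscoefM_order f g p q m :
  (forall a, (mdeg a < p)%N -> f a = 0) ->
  (forall a, (mdeg a < q)%N -> g a = 0) ->
  (mdeg m < p + q)%N -> (f * g) m = 0.
Proof.
move=> f0 g0 mpq; apply: big1 => -[[a la] [b lb]] /= /eqP E.
case: (ltnP (mdeg a) p) => [/f0->|pa]; first by rewrite mul0r.
rewrite g0 ?mulr0 //; move: mpq; rewrite E mdegD => lt.
by rewrite -(ltn_add2l (mdeg a)) (leq_trans lt) // leq_add2r.
Qed.

Lemma pscoefX_order x i m : x \in max_ideal -> (mdeg m < i)%N -> (x ^+ i) m = 0.
Proof.
move=> /eqP x0; elim: i m => // i IHi m mi; rewrite exprS.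
apply: (@pscoefM_order _ _ 1 i) => // a; rewrite ltnS leqn0 mdeg_eq0 => /eqP->.
exact: x0.
Qed.

Lemma eq_pscoefMr f g h m :
  (forall a, (mdeg a <= mdeg m)%N -> g a = h a) -> (f * g) m = (f * h) m.
Proof. by move=> gh; apply: eq_bigr => -[[a la] [b lb]] /= _; rewrite gh. Qed.

Lemma max_idealMl f x : x \in max_ideal -> f * x \in max_ideal.
Proof. by move=> /eqP x0; apply/eqP; rewrite pscoefM0 x0 mulr0. Qed.

(** The inverse is the geometric series: [x ^+ i] has order at least [i], so the coefficient at [m]
    is already that of the partial sum with [(mdeg m).+1] terms. *)
Lemma geometric_inverse x : x \in max_ideal -> exists h, h * (1 - x) = 1.
Proof.
move=> xm; pose s d : R := \sum_(i < d) x ^+ i.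
have sE d m : (mdeg m < d)%N -> s d m = s (mdeg m).+1 m.
  move=> /subnKC <-; rewrite /s !pscoef_sum big_split_ord /= [X in _ + X]big1 ?addr0 // => i _.
  by rewrite pscoefX_order // ltnS leq_addr.
exists (PSeries (fun m => s (mdeg m).+1 m)); apply: pseriesP => m.
rewrite mulrC (@eq_pscoefMr _ _ (s (mdeg m).+1)); last first.
  by move=> a am; rewrite [RHS]sE.
have -> : (1 - x) * s (mdeg m).+1 = 1 - x ^+ (mdeg m).+1.
  by rewrite -[in RHS](expr1n _ (mdeg m).+1) subrXX; congr (_ * _);
     apply: eq_bigr => i _; rewrite expr1n mul1r.
by rewrite -[LHS]/(_ + - _) [X in - X](@pscoefX_order _ _ m) // subr0.
Qed.

Definition psC (c : k) : R := PSeries (fun m => c * (m == 0%MM)%:R).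

Lemma pscoef_psCM (c : k) f m : (psC c * f) m = c * f m.
Proof.
rewrite -[LHS]/(ps_mul _ f m).
rewrite (@ps_mul_mpoly _ _ _ f c%:MP (ps_trunc (mdeg m).+1 f)).
- by rewrite mcoeffCM ps_truncE.
- by move=> a _; rewrite mcoeffC.
- by move=> a am; rewrite ps_truncE.
Qed.

(** Dividing [f] by its constant term gives [1] minus an element of the maximal ideal. *)
Lemma pseries_inverse f : f \notin max_ideal -> exists h, h * f = 1.
Proof.
move=> f0; pose c := psC (f 0%MM)^-1.
have /geometric_inverse[h hE] : 1 - c * f \in max_ideal.
  by apply/eqP; rewrite -[LHS]/(_ + - _) [X in - X]pscoef_psCM /= eqxx mulVf ?subrr.
by exists (h * c); rewrite -mulrA -[c * f](subKr 1).
Qed.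

Definition psX (c : 'X_{1..n}) : R := PSeries (fun m => (m == c)%:R).

Lemma pscoef_psXM (c m : 'X_{1..n}) h : (psX c * h) m = if (c <= m)%MM then h (m - c)%MM else 0.
Proof.
rewrite -[LHS]/(ps_mul _ h m).
rewrite (@ps_mul_mpoly _ _ _ h 'X_[c] (ps_trunc (mdeg m).+1 h)).
- case: ifP => [cm|ncm].
    rewrite mulrC -[X in _@_X](submK cm) addmC mcoeffMX ps_truncE //.
    by rewrite ltnS mdegB.
  rewrite mcoeffM big1 // => -[[a la] [b lb]] /= /eqP E.
  rewrite mcoeffX; case: eqP => [e|]; rewrite ?mul0r //.
  by rewrite E e lem_addr in ncm.
- by move=> a _; rewrite mcoeffX eq_sym.
- by move=> a am; rewrite ps_truncE.
Qed.

(* Each nonconstant monomial [m] is charged to one variable dividing it, so that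
   [f] is the sum over [i] of [x_i] times the part charged to [i]. *)
Lemma order_ideal_exp N f :
  (forall a, (mdeg a < N)%N -> f a = 0) -> f \in ideal_exp max_ideal N.
Proof.
elim: N f => // N IHN f f0; apply/asboolP.
pose var m := [pick j : 'I_n | m j != 0%N].
pose part i : R := PSeries (fun m =>
  if var (m + U_(i))%MM == Some i then f (m + U_(i))%MM else 0).
exists [seq (psX U_(i), part i) | i <- enum 'I_n].
  apply/allP => _ /mapP[i _ ->] /=; apply/andP; split.
    by apply/eqP; rewrite /= eq_sym -mdeg_eq0 mdeg1.
  apply: IHN => a aN /=; case: ifP => // _.
  by rewrite f0 // mdegD mdeg1 addn1.
rewrite big_map big_enum /=; apply: pseriesP => m; rewrite pscoef_sum.
transitivity (\sum_(i < n) if var m == Some i then f m else 0); last first.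
  apply: eq_bigr => i _; rewrite pscoef_psXM lep1mP /=; case: (boolP (m i != 0%N)) => [mi|].
    by rewrite submK ?lep1mP.
  rewrite negbK => mi; case: eqP => //; rewrite /var; case: pickP => // j mj [ji].
  by rewrite -ji (negbTE mj) in mi.
rewrite /var; case: pickP => [j mj|m0].
  rewrite (bigD1 j) //= eqxx big1 ?addr0 // => i ij.
  by case: eqP => // -[ji]; rewrite ji eqxx in ij.
rewrite big1 // f0 // (_ : m = 0%MM) ?mdeg0 //; apply/mnmP => i.
by have /negbFE/eqP-> := m0 i; rewrite mnm0E.
Qed.

End Series.

(** A matrix [A] of maximal rank with row space inside [W] spans [W], since a row of [W] outside it
    would raise the rank. The columns of [cokermx A] then vanish on [W], and one of them detects
    [v]. *)
Lemma separating_col (K : fieldType) d (W : {pred 'rV[K]_d}) (v : 'rV[K]_d) :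
  submod_closed W -> v \notin W ->
  exists u : 'cV[K]_d, (forall w, w \in W -> w *m u = 0) /\ v *m u != 0.
Proof.
move=> [W0 WL] vW.
pose P r := `[< exists2 A : 'M[K]_d, \rank A = r
  & forall w : 'rV_d, (w <= A)%MS -> w \in W >].
have exP : exists r, P r.
  exists 0%N; apply/asboolP; exists 0; rewrite ?mxrank0 // => w.
  by rewrite submx0 => /eqP->.
have ubP r : P r -> (r <= d)%N by move=> /asboolP[A <- _]; apply: rank_leq_col.
case: (ex_maxnP exP ubP) => r /asboolP[A rA AW] maxr.
have WA w : w \in W -> (w <= A)%MS.
  move=> wW; apply/negPn/negP => wA.
  have : P (\rank (A + w)%MS).
    apply/asboolP; exists (A + w)%MS => // _ /sub_addsmxP[[p q] -> /=].
    rewrite addrC [q]mx11_scalar mul_scalar_mx; apply: WL => //.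
    by apply: AW; rewrite submxMl.
  move=> /maxr; rewrite leqNgt -rA => /negP[]; apply: rank_ltmx.
  rewrite ltmxE addsmxSl /=; apply: contra wA => Aw.
  by apply: submx_trans Aw; apply: addsmxSr.
have : v *m cokermx A != 0 by rewrite -submxE; apply: contra vW => /AW.
case/matrix0Pn => i [j ij].
exists (col j (cokermx A)); split=> [w /WA|].
  by rewrite submxE colE mulmxA => /eqP->; rewrite mul0mx.
apply: contraNneq ij => e; have := congr1 (fun B : 'cV[K]_1 => B i 0) e.
by rewrite colE mulmxA -colE !mxE => ->.
Qed.

(** * Duality between ideals and their perps *)

Section Duality.
Variables (k : fieldType) (n : nat).
Local Notation R := (pseries k n).
Local Notation S := (contr_poly k n).
Implicit Types (I J : {pred R^o}) (f g h x : R) (F G : S).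

(* The partial products [x_1 ... x_j] give, in reverse order, a chain above [J].
   If two consecutive terms agree, then [x_1 ... x_j (1 - x_{j+1} r)] is in [J],
   where the last factor is a unit. The default value [0] of [nth] makes [J] the
   bottom of the chain. *)
Lemma prod_max_ideal J l (xs : seq R) : submod_closed J ->
  (forall M l', chain_above J M l' -> (l' <= l)%N) ->
  {subset xs <= max_ideal} -> size xs = l -> \prod_(x <- xs) x \in J.
Proof.
move=> [J0 JL] maxl xsm xsl; apply/negPn/negP => pJ.
have JD u v : u \in J -> v \in J -> u + v \in J.
  by move=> uJ vJ; rewrite -[u]scale1r; apply: JL.
have JM (a : R) u : u \in J -> a * u \in J.
  by move=> uJ; rewrite -[a * u]addr0; apply: JL.
pose p j : R := \prod_(0 <= i < j) xs`_i.
have pS j : p j.+1 = p j * xs`_j by rewrite /p big_nat_recr.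
have pl j : (j <= l)%N -> p j \notin J.
  move=> jl; apply: contra pJ => pjJ.
  rewrite (big_nth 0) xsl (big_cat_nat (n := j)) //= mulrC.
  exact: JM.
have xm j : xs`_j \in max_ideal.
  case: (ltnP j (size xs)) => js; first by apply/xsm/mem_nth.
  by rewrite nth_default // unfold_in /= eqxx.
pose M i : {pred R^o} := fun f => `[< exists r : R, f - r * p (l.+1 - i)%N \in J >].
suff /maxl : chain_above J M l.+1 by rewrite ltnn.
split; first split=> i il.
- split=> [|a u v /asboolP[r uJ] /asboolP[s vJ]]; apply/asboolP.
    by exists 0; rewrite mul0r subr0.
  exists (a * r + s).
  rewrite (_ : _ - _ = a *: (u - r * p (l.+1 - i)%N) + (v - s * p (l.+1 - i)%N)).
    exact: JL.
  have idn (b u' v' r' s' q : R) :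
    b * u' + v' - (b * r' + s') * q = b * (u' - r' * q) + (v' - s' * q) by ring.
  exact: idn.
- have e : (l.+1 - i)%N = (l.+1 - i.+1).+1 by rewrite subSn // subSS.
  split=> [f /asboolP[r fJ]|MM].
    apply/asboolP; exists (r * xs`_(l.+1 - i.+1)).
    by rewrite -mulrA [xs`__ * _]mulrC -pS -e.
  set j := (l.+1 - i.+1)%N in e.
  have : p j \in M i.+1 by apply/asboolP; exists 1; rewrite mul1r subrr.
  move=> /MM/asboolP[r]; rewrite e pS.
  have [h hE] := geometric_inverse (max_idealMl r (xm j)).
  move=> /(JM h); have -> : h * (p j - r * (p j * xs`_j)) = p j * (h * (1 - r * xs`_j)).
    ring.
  by rewrite hE mulr1; apply/negP/pl; rewrite leq_subLR addSn ltnS leq_addl.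
- move=> f fJ; apply/asboolP; exists 0; rewrite mul0r subr0 //.
Qed.

Lemma ideal_exp_sub J l : submod_closed J ->
  (forall M l', chain_above J M l' -> (l' <= l)%N) ->
  {subset ideal_exp max_ideal l <= J}.
Proof.
move=> Jcl maxl; have [J0 JL] := Jcl.
(* The list [xs] holds the factors already split off; once [j] is 0 there are [l] of them and
   [prod_max_ideal] applies. *)
suff H j f (xs : seq R) : f \in ideal_exp max_ideal j ->
    {subset xs <= max_ideal} -> (size xs + j)%N = l -> (\prod_(x <- xs) x) * f \in J.
  by move=> f fm; have := H l f [::] fm _ erefl; rewrite big_nil mul1r; apply.
elim: j f xs => [|j IHj] f xs fm xsm xsl.
  rewrite mulrC -[_ * _]addr0; apply: JL => //.
  by apply: prod_max_ideal maxl _ _; rewrite // -xsl addn0.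
have /asboolP[s /allP sm ->] := fm; rewrite mulr_sumr.
rewrite big_seq; apply: (big_ind (fun g => g \in J)) => [//|u v uJ vJ|[y z] /= /sm /andP[ym zm]].
  by have := JL 1 u v uJ vJ; rewrite scale1r.
rewrite (_ : _ * (y * z) = (\prod_(x <- y :: xs) x) * z); last first.
  by rewrite big_cons mulrA [y * _]mulrC.
apply: IHj => //.
  by move=> x; rewrite inE => /predU1P[->//|]; apply: xsm.
by rewrite -xsl /= addSnnS.
Qed.

(** Evaluated at [f *: G], this is the [k]-bilinear pairing of series with polynomials. *)
Definition ccoef (G : S) : k := mcoeff 0%MM (G : {mpoly k[n]}).

Lemma mcoeff_psX_contract m (G : S) : ccoef (psX k m *: G) = mcoeff m (G : {mpoly k[n]}).
Proof.
rewrite -[LHS]/((contract (psX k m) G)@_0).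
rewrite (@mcoeff_contract _ _ (maxn (msize (G : {mpoly k[n]})) (mdeg m).+1)) ?leq_maxl //.
have md : (mdeg m < maxn (msize (G : {mpoly k[n]})) (mdeg m).+1)%N by rewrite leq_maxr.
rewrite (bigD1 (BMultinom md)) //= eqxx mul1r add0m big1 ?addr0 // => a.
by rewrite bmeqP /= => /negbTE->; rewrite mul0r.
Qed.

(** Modulo series of order at least [N], a series is a finite row of coefficients. A linear
    functional on such rows that kills [J] but not [f] is the pairing with a polynomial [G]. *)
Lemma separating_poly J N f : submod_closed J ->
  {subset ideal_exp max_ideal N <= J} -> f \notin J ->
  exists2 G : S, G \in perp J & f *: G != 0.
Proof.
move=> [J0 JL] JN fJ.
pose d := #|{: 'X_{1..n < N}}|.
pose trunc g : 'rV[k]_d := \row_j g (enum_val j : 'X_{1..n < N}).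
pose W : {pred 'rV[k]_d} := fun w => `[< exists2 g : R, g \in J & w = trunc g >].
have Wcl : submod_closed W.
  split=> [|c _ _ /asboolP[g gJ ->] /asboolP[h hJ ->]]; apply/asboolP.
    by exists 0 => //; apply/rowP => j; rewrite !mxE.
  exists (psC n c * g + h); first exact: (JL (psC n c)).
  by apply/rowP => j; rewrite !mxE -[RHS]/(_ + _) [X in _ = X + _]pscoef_psCM.
(* Truncation forgets only series of order at least [N], and these lie in [J]. *)
have fW : trunc f \notin W.
  apply: contra fJ => /asboolP[g gJ fg]; rewrite -[f](subrK g).
  have : f - g \in J.
    apply/JN/order_ideal_exp => a aN; rewrite -[LHS]/(f a - g a).
    have /rowP/(_ (enum_rank (BMultinom aN))) := fg.
    by rewrite !mxE enum_rankK => ->; rewrite subrr.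
  by move=> fgJ; have := JL 1 _ _ fgJ gJ; rewrite scale1r.
have [u [uW fu]] := separating_col Wcl fW.
pose G : {mpoly k[n]} := \sum_(a : 'X_{1..n < N}) u (enum_rank a) 0 *: 'X_[a].
have GN : (msize G <= N)%N.
  apply: leq_trans (msize_sum _ _ _) _; apply/bigmax_leqP => a _.
  by apply: leq_trans (msizeZ_le _ _) _; rewrite msizeX bmdeg.
have Gcoef (a : 'X_{1..n < N}) : G@_a = u (enum_rank a) 0.
  rewrite raddf_sum (bigD1 a) //= mcoeffZ mcoeffX eqxx mulr1 big1 ?addr0 // => b.
  by rewrite mcoeffZ mcoeffX bmeqP => /negbTE->; rewrite mulr0.
have pairing g : ccoef (g *: (G : S)) = (trunc g *m u) 0 0.
  rewrite -[LHS]/((contract g G)@_0) (mcoeff_contract _ _ GN) mxE.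
  rewrite [RHS](reindex (@enum_rank 'X_{1..n < N})) /=; last first.
    exact: onW_bij (enum_rank_bij _).
  by apply: eq_bigr => a _; rewrite add0m Gcoef mxE enum_rankK.
exists (G : S).
  (* The coefficient of [g *: G] at [m] is the pairing of [psX k m * g] with [G], and this multiple
     of [g] is still in [J]. *)
  apply/asboolP => g gJ; apply/mpolyP => m; rewrite mcoeff0.
  rewrite -mcoeff_psX_contract scalerA pairing uW ?mxE //.
  apply/asboolP; exists (psX k m * g) => //.
  by rewrite -[_ * g]addr0; apply: (JL (psX k m)).
apply: contraNneq fu => fG; apply/eqP/matrixP => i j; rewrite !ord1 -pairing fG mxE.
exact: mcoeff0.
Qed.

Definition colon (M : {pred S}) F : {pred R^o} := fun f => f *: F \in M.

Lemma colon_closed (M : {pred S}) F : submod_closed M -> submod_closed (colon M F).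
Proof.
move=> [M0 ML]; split=> [|a u v]; rewrite !unfold_in ?scale0r //.
by rewrite scalerDl -scalerA; apply: ML.
Qed.

Lemma perp_sub I J : {subset I <= J} -> {subset (perp J : {pred S}) <= perp I}.
Proof. by move=> IJ G /asboolP GJ; apply/asboolP => f /IJ/GJ. Qed.

Lemma chain_above_annihilator I F N (A M : nat -> {pred R^o}) a l :
  {subset ideal_exp max_ideal N <= I} -> {subset (perp I : {pred S}) <= cyclic_submod F} ->
  chain_above I A a -> chain_above (colon (perp I) F) M l ->
  exists B, chain_above (annihilator F) B (a + l)%N.
Proof.
move=> IN Fcov [Ach IA] [Mch IM].
have [Acl Alt] := Ach.
pose K i := colon (perp (A (a - i)%N)) F.
have Kcl i : submod_closed (K i) by apply/colon_closed/perp_closed.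
have Kch : submod_chain K a.
  split=> // i ia; have e : (a - i)%N = (a - i.+1).+1 by rewrite -subSn // subSS.
  have ja : (a - i.+1 < a)%N by rewrite -e leq_subr.
  have [Aj nAj] := Alt _ ja; split=> [f|KK].
    by rewrite !unfold_in /K e; apply: perp_sub.
  (* An [f] in the larger ideal only is detected by some [G] in the perp of the smaller one. The
     cover gives [G = g *: F], and [g] then lies in [K i.+1] but not in [K i]. *)
  apply: nAj => f fA; apply/negPn/negP => fnA.
  have IAj : {subset I <= A (a - i.+1)%N}.
    by move=> g /IA; apply: (submod_chain_mono Ach (leq0n _) (ltnW ja)).
  have NAj : {subset ideal_exp max_ideal N <= A (a - i.+1)%N} by move=> g /IN/IAj.
  have [G GA /negP[]] := separating_poly (Acl _ (ltnW ja)) NAj fnA.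
  have /Fcov/asboolP[g Gg] : G \in perp I by apply: perp_sub GA.
  have : g \in K i.+1 by rewrite unfold_in /colon -Gg.
  by move=> /KK; rewrite unfold_in /colon /K e -Gg => /asboolP/(_ f fA)->.
eexists; split.
  apply: submod_chain_cat Kch Mch _ => f fK; apply: IM; move: fK.
  by rewrite !unfold_in /K /colon subnn; apply: perp_sub.
have IM0 : {subset annihilator F <= colon (perp I) F}.
  by move=> f /eqP fF; rewrite unfold_in /colon fF; have [] := perp_closed S I.
(* The bottom of the glued chain is [K 0] if [a] is positive and [M 0] if [a] is 0; both contain the
   annihilator of [F]. *)
move=> f /[dup] /eqP fF /IM0 /IM fM /=; case: ifP => _; last by rewrite sub0n.
by rewrite unfold_in /K /colon fF; have [] := perp_closed S (A (a - 0)%N).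
Qed.


End Duality.

(** * Gorenstein covers and their unit multiples *)

Section Covers.
Variables (k : fieldType) (n : nat).
Local Notation R := (pseries k n).
Local Notation S := (contr_poly k n).
Implicit Types (I : ideal R) (f g u v : R) (F G H : S).

Lemma colength_ideal_exp_sub I a :
  colength I a -> {subset ideal_exp max_ideal a <= I}.
Proof. by case=> _; apply: ideal_exp_sub; apply: submodClosedP. Qed.

(** Here [H] generates [perp I], so the claim is the duality between [I] and the annihilator of
    [perp I]: an [f] outside [I] acts nontrivially on some multiple of [H]. *)
Lemma cyclic_perp_annihilator I a H :
  colength I a -> gorenstein_cover I H -> H \in perp I -> I =i annihilator H.
Proof.
move=> Ia Hcov /asboolP HI f; apply/idP/idP => [/HI fH|/eqP fH]; first exact/eqP.
apply/negPn/negP => fI.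
have [G GI /negP[]] := separating_poly (submodClosedP I) (colength_ideal_exp_sub Ia) fI.
have /asboolP[g ->] := Hcov _ GI.
by rewrite scalerA mulrC -scalerA fH scaler0.
Qed.

(** Positivity of [t] matters: if [t] is 0 and [R / I] is nonzero, a generator [H] of [perp I] is
    congruent to [H' = 0]. *)
Lemma gcl_gt0_cover_unit I t H H' :
  has_gcl I t -> (0 < t)%N -> gorenstein_cover I H ->
  quotmod_pi (perp I) H = quotmod_pi (perp I) H' ->
  exists u v, v * u = 1 /\ H' = u *: H.
Proof.
move=> [[F0 [_ [a [_ [Ia _ _]]]]] tmin] t0 Hcov /quotmod_piP HH'.
have /asboolP[g gE] := Hcov _ HH'.
have H'E : H' = (1 - g) *: H by rewrite scalerBl scale1r -gE subKr.
have [gm|gm] := boolP (g \in max_ideal).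
  by have [v vE] := geometric_inverse gm; exists (1 - g), v.
have [h hg] := pseries_inverse gm.
have HI : H \in perp I.
  rewrite -[H]scale1r -hg -scalerA -gE -[_ *: _]addr0.
  by have [P0 PL] := perp_closed S I; apply: PL.
(* A cover [H] inside [perp I] has annihilator [I], hence gap 0, against the minimality of [t]. *)
suff /(tmin _ _ Hcov) : length_gap I H 0 by rewrite leqNgt t0.
exists a, a; split; rewrite ?addn0 //; apply/has_length_quotmod.
move/has_length_quotmod in Ia.
exact: eq_colength (cyclic_perp_annihilator Ia Hcov HI) Ia.
Qed.

Lemma cyclic_submodZ u v H : v * u = 1 -> cyclic_submod (u *: H) =i cyclic_submod H.
Proof.
move=> vu G; apply/asboolP/asboolP => -[f ->].
  by exists (f * u); rewrite scalerA.
by exists (f * v); rewrite scalerA -mulrA vu mulr1.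
Qed.

Lemma annihilatorZ u v H : v * u = 1 -> annihilator (u *: H) =i annihilator H.
Proof.
move=> vu f; rewrite !unfold_in; apply/eqP/eqP => [fuH|fH].
  have -> : f *: H = v *: (f *: (u *: H)) by rewrite !scalerA mulrAC vu mul1r.
  by rewrite fuH scaler0.
by rewrite scalerA mulrC -scalerA fH scaler0.
Qed.

Lemma gcl_uniq I t t' : has_gcl I t -> has_gcl I t' -> t = t'.
Proof.
move=> [[F [cF gF]] tmin] [[F' [cF' gF']] t'min].
by apply/eqP; rewrite eqn_leq (tmin _ _ cF' gF') (t'min _ _ cF gF).
Qed.

(** A chain of length [l] above the colon ideal of [perp I] by [F] extends to one of length [a + l]
    above the annihilator of [F], whose colength is [a + t]. Hence [l] is at most [t], and the
    [t]-th power of the maximal ideal lies in the colon ideal. *)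
Lemma cover_integral I F t : gorenstein_cover I F -> length_gap I F t ->
  F \in integral (ideal_exp max_ideal t) (perp I).
Proof.
move=> Fcov [a [g [/has_length_quotmod Ia /has_length_quotmod [_ Fmax] ga]]].
apply/asboolP => f fm.
suff : f \in colon (perp I) F by [].
apply: ideal_exp_sub fm; first exact/colon_closed/perp_closed.
move=> M l Mch; have [[A Ach] _] := Ia.
have [B /Fmax] := chain_above_annihilator (colength_ideal_exp_sub Ia) Fcov Ach Mch.
by rewrite ga leq_add2l.
Qed.

End Covers.

Theorem proposition3p6 (k : fieldType) (n : nat) (I : ideal (pseries k n))
    (t : nat) (F : contr_poly k n)
    (A_artin : artinian (quotmod I))
    (gcl_A : has_gcl I t)
    (F_min : minimal_gorenstein_cover I F) :
  [/\ F \in integral (ideal_exp max_ideal t) (perp I),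
      (0 < t)%N ->
        forall H H' : contr_poly k n,
          H \in integral (ideal_exp max_ideal t) (perp I) ->
          H' \in integral (ideal_exp max_ideal t) (perp I) ->
          quotmod_pi (perp I) H = quotmod_pi (perp I) H' ->
          {subset perp I <= cyclic_submod H} <->
          {subset perp I <= cyclic_submod H'}
    & (0 < t)%N ->
        forall F' : contr_poly k n,
          F' \in integral (ideal_exp max_ideal t) (perp I) ->
          quotmod_pi (perp I) F' = quotmod_pi (perp I) F ->
          minimal_gorenstein_cover I F' /\ annihilator F' =i annihilator F].
Proof.
have [Fcov [t' [gcl_t' Fgap]]] := F_min.
have cov_congr H H' : (0 < t)%N -> gorenstein_cover I H ->
    quotmod_pi (perp I) H = quotmod_pi (perp I) H' -> gorenstein_cover I H'.
  move=> t0 Hcov /(gcl_gt0_cover_unit gcl_A t0 Hcov)[u [v [vu ->]]] G /Hcov.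
  by rewrite (cyclic_submodZ _ vu).
split=> [|t0 H H' _ _ HH'|t0 F' _ /esym FF'].
(* The gap [t'] of the minimal cover is identified with [t] by uniqueness of the Gorenstein
   colength. *)
- by rewrite (gcl_uniq gcl_A gcl_t'); apply: cover_integral.
- by split=> Hcov; [apply: cov_congr HH' | apply: cov_congr (esym HH')].
have [u [v [vu F'E]]] := gcl_gt0_cover_unit gcl_A t0 Fcov FF'.
have annE : annihilator F' =i annihilator F by rewrite F'E; apply: annihilatorZ vu.
split=> //; split; first exact: cov_congr FF'.
(* Equal annihilators give quotients of the same length, so [F'] inherits the gap of [F]. *)
exists t'; split=> //; have [a [g [Ia Fg ag]]] := Fgap.
exists a, g; split=> //; apply/has_length_quotmod; move/has_length_quotmod in Fg.
by apply: eq_colength Fg => f; rewrite annE.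
Qed.
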